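(* Let $N \geq 1$ and $M > 1$ be integers, let $p, \alpha, \theta \in [0,1]$, and let $r \leq N$ be the minimum number of questions that a student must get correct in order to pass the exam, all as described in the context. Let $$\beta = p\alpha + \frac{(1-p)(1-\alpha)}{M-1}.$$ The ratio $\mu$ of the probability that a beneficiary using the attack will pass the exam to the probability that the same student would have passed the exam under the clean option is given by $$\mu = \frac{\sum_{k=r}^{N} \binom{N}{k} \beta^k (1-\beta)^{N-k}}{\sum_{k=r}^{N} \binom{N}{k} \theta^k (1-\theta)^{N-k}}.$$
   Context: An exam has $N$ multiple choice questions, each with $M$ answer options, from which only one has to be selected as the correct answer. A score of at least $r$ correct questions means that the student passes the exam. Attack. A knowledgeable student (the ''mercenary'') answers the questions and communicates each chosen answer, encoded as a wrist gesture, to a weak student (the ''beneficiary'') through a gesture classification system. The mercenary's gestures are recognized by the classification system with an accuracy of $\alpha$ on average, where $0 \le \alpha \le 1$ (the mercenary's ''skill''). The mercenary's probability of answering a question correctly is $p$, where $0 \le p \le 1$ (the mercenary's ''knowledge''). The beneficiary relies entirely on the answers provided by the attack and cannot override an answer provided by the system. The random variable $X$ is the number of questions the beneficiary passes (gets correct) when the attack is used; the beneficiary passes the exam when $X \geq r$. Clean option. This is the scenario in which the same student opts not to cheat (the attack is not used). The student's probability of passing (getting correct) an individual question under the clean option is $\theta$, where $0 \le \theta \le 1$. The random variable $Y$ is the number of questions the student would have passed under the clean option; the student passes the exam when $Y \geq r$.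
   Formalization: Assumed in addition: in each scenario the questions are mutually independent; recognition of a gesture is independent of whether the answer is correct; a misrecognized gesture is equally likely to be read as each of the M−1 other options. *)

(* Defs.v *)
From HB Require Import structures.
From mathcomp Require Import all_boot all_order all_algebra.
From mathcomp Require Import all_classical all_reals all_analysis.

Set Implicit Arguments.
Unset Strict Implicit.
Unset Printing Implicit Defensive.

Import Order.TTheory GRing.Theory Num.Theory.

Local Open Scope classical_set_scope.
Local Open Scope ring_scope.

(* Measurability for the discrete sigma-algebra on the values. Since 'I_M is
   empty for M = 0 it is not a pointedType, hence not a measurableType, and
   {RV P >-> 'I_M} is not available. *)
Definition discrete_rv d (T : measurableType d) (S : finType) (X : T -> S) :
    Prop :=
  forall E : set S, measurable (X @^-1` E).

Definition mutually_independent d (T : measurableType d) (R : realType)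
    (P : probability T R) (I S : finType) (X : I -> T -> S) : Prop :=
  forall (J : {set I}) (E : I -> set S),
    P (\bigcap_(i in [set` J]) (X i @^-1` E i)) =
    (\prod_(i in J) P (X i @^-1` E i))%E.

(* [key i] is the correct option of question i, [answer i] the option chosen by
   the mercenary, and [received i] the option output by the gesture classifier,
   which the beneficiary copies unchanged. The accuracy alpha is the overall
   probability of recognition, averaged over the gestures made: individual
   options may be recognized more or less accurately. *)
Record attack d (T : measurableType d) (R : realType) (P : probability T R)
    (N M : nat) (p alpha : R) (key : 'I_N -> 'I_M)
    (answer received : 'I_N -> T -> 'I_M) : Prop := {
  attack_answer_rv : forall i, discrete_rv (answer i);
  attack_received_rv : forall i, discrete_rv (received i);
  attack_knowledge : forall i, P [set t | answer i t = key i] = p%:E;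
  attack_skill : forall i, P [set t | received i t = answer i t] = alpha%:E;
  (* recognizing a gesture is independent of the answer being correct *)
  attack_skill_knowledge : forall i,
    P ([set t | answer i t = key i] `&` [set t | received i t = answer i t]) =
    (P [set t | answer i t = key i] *
     P [set t | received i t = answer i t])%E;
  (* a misrecognized gesture is equally likely to be taken for each of the
     M - 1 other options *)
  attack_confusion : forall i (a b : 'I_M), b != a ->
    P [set t | answer i t = a /\ received i t = b] =
    (P [set t | answer i t = a /\ received i t <> a] *
     ((M%:R - 1)^-1)%:E)%E;
  attack_questions_independent :
    mutually_independent P (fun i t => (answer i t, received i t)) }.

Record clean_option d (T : measurableType d) (R : realType)
    (P : probability T R) (N : nat) (theta : R)
    (correct : 'I_N -> T -> bool) : Prop := {
  clean_correct_rv : forall i, discrete_rv (correct i);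
  clean_theta : forall i, P [set t | correct i t] = theta%:E;
  clean_questions_independent : mutually_independent P correct }.

Definition score (T : Type) (N : nat) (correct : 'I_N -> T -> bool) (t : T) :
    nat :=
  (\sum_(i < N) correct i t)%N.

Definition pass_probability d (T : measurableType d) (R : realType)
    (P : probability T R) (r : nat) (X : T -> nat) : R :=
  fine (P [set t | (r <= X t)%N]).

(* As usual for real division, the value is 0 when P (Y >= r) = 0. *)
Definition pass_ratio d (T : measurableType d) (R : realType)
    (P : probability T R) (r : nat) (X Y : T -> nat) : R :=
  pass_probability P r X / pass_probability P r Y.

(* Main.v *)
(* A received option is the correct one either because a correct answer was
   recognized, with probability p alpha, or because a wrong answer a was
   misrecognized as the key; summing the latter over a <> key gives
   P (wrong and misrecognized) / (M - 1) = (1 - p) (1 - alpha) / (M - 1).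
   Scores are then binomial: independence gives the law of the set of correctly
   answered questions, and there are 'C(N, k) such sets of size k. *)
Require Import Defs.
From HB Require Import structures.
From mathcomp Require Import all_boot all_order all_algebra.
From mathcomp Require Import all_classical all_reals all_analysis.
From mathcomp Require Import lra.

Import Order.TTheory GRing.Theory Num.Theory.

Set Implicit Arguments.
Unset Strict Implicit.
Unset Printing Implicit Defensive.

Local Open Scope classical_set_scope.
Local Open Scope ring_scope.

Lemma discrete_rvP d (T : measurableType d) (S : finType) (X : T -> S) :
  (forall s, measurable (X @^-1` [set s])) -> discrete_rv X.
Proof.
move=> mX E.
rewrite (_ : X @^-1` E = \bigcup_(s in E) (X @^-1` [set s])); last first.
  by apply/seteqP; split=> [t /= Et|t /= [s Es ->]//]; exists (X t).
by apply: fin_bigcup_measurable => //; exact: finite_finset.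
Qed.

Lemma discrete_rv_pair d (T : measurableType d) (S S' : finType)
    (X : T -> S) (Y : T -> S') :
  discrete_rv X -> discrete_rv Y -> discrete_rv (fun t => (X t, Y t)).
Proof.
move=> mX mY; apply: discrete_rvP => -[x y].
rewrite (_ : _ @^-1` _ = X @^-1` [set x] `&` Y @^-1` [set y]).
  exact: measurableI.
by apply/seteqP; split=> [t /= [<- <-]//|t /= [<- <-]].
Qed.

(** Law of total probability. It serves twice: with [X] the set of correctly answered questions, and
    with [X] the option chosen by the mercenary. *)
Lemma probability_partition d (T : measurableType d) (R : realType)
    (P : probability T R) (S : finType) (X : T -> S) (A : set T) :
  discrete_rv X -> measurable A ->
  P A = (\sum_s P (A `&` X @^-1` [set s]))%E.
Proof.
move=> mX mA.
rewrite fsbig_seq ?index_enum_uniq//= -measure_fin_bigcup.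
- congr (P _); apply/seteqP; split=> [t At|t [s _ []]//].
  by exists (X t) => //=; rewrite mem_index_enum.
- exact: finite_finset.
- apply/trivIsetP => i j _ _ ij; apply/seteqP; split=> // t [] [_ /= Xi] [_ /= Xj].
  by rewrite -Xi -Xj eqxx in ij.
- by move=> s _; exact: measurableI.
Qed.

(** Every event about [f i (X i t)] is already an event about [X i t]. The map [f] depends on [i]
    because each question has its own key. *)
Lemma mutually_independent_comp d (T : measurableType d) (R : realType)
    (P : probability T R) (I S S' : finType) (X : I -> T -> S)
    (f : I -> S -> S') :
  mutually_independent P X ->
  mutually_independent P (fun i t => f i (X i t)).
Proof. by move=> indX J E; exact: indX J (fun i => f i @^-1` E i). Qed.

(** The score is the cardinal of this random set. Fixing the whole set, and not only its size,
    prescribes the outcome of each question, so that independence yields a plain product. *)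
Definition correct_set (T : Type) (I : finType) (B : I -> T -> bool) (t : T) :
  {set I} := [set i | B i t]%SET.

Lemma preimage_correct_set (T : Type) (I : finType) (B : I -> T -> bool)
    (A : {set I}) :
  correct_set B @^-1` [set A] =
  \bigcap_(i in [set` [set: I]%SET]) (B i @^-1` [set i \in A]).
Proof.
apply/seteqP; split=> [t /= <- i _|t /= BA]; first by rewrite inE.
by apply/setP => i; rewrite inE; apply: BA => /=; rewrite inE.
Qed.

Lemma discrete_rv_correct_set d (T : measurableType d) (I : finType)
    (B : I -> T -> bool) :
  (forall i, discrete_rv (B i)) -> discrete_rv (correct_set B).
Proof.
move=> mB; apply: discrete_rvP => A; rewrite preimage_correct_set.
by apply: fin_bigcap_measurable => [|i _]; [exact: finite_finset|exact: mB].
Qed.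

Lemma probability_correct_set d (T : measurableType d) (R : realType)
    (P : probability T R) (I : finType) (B : I -> T -> bool) (b : R)
    (A : {set I}) :
  (forall i, discrete_rv (B i)) -> mutually_independent P B ->
  (forall i, P [set t | B i t] = b%:E) ->
  P (correct_set B @^-1` [set A]) =
  (b ^+ #|A| * (1 - b) ^+ (#|I| - #|A|))%:E.
Proof.
move=> mB indB PB; rewrite preimage_correct_set indB.
rewrite (eq_bigr (fun i => (if i \in A then b else 1 - b)%:E)); last first.
  move=> i _; case: (i \in A).
    by rewrite -(PB i); congr (P _).
  rewrite EFinB -(PB i) -probability_setC; last exact: (mB i [set true]).
  by congr (P _); apply/seteqP; split=> t /=; case: (B i t).
rewrite prodEFin (eq_bigl xpredT) => [|i]; last by rewrite inE.
(* The product splits into a factor [b] for each index in [A] and [1 - b] for each index outside. *)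
rewrite big_if/= prodr_const (prodr_const [predC A]).
by rewrite -(cardC A) addKn.
Qed.

Lemma pass_probability_binomial d (T : measurableType d) (R : realType)
    (P : probability T R) (N r : nat) (B : 'I_N -> T -> bool) (b : R) :
  (forall i, discrete_rv (B i)) -> mutually_independent P B ->
  (forall i, P [set t | B i t] = b%:E) ->
  pass_probability P r (score B) =
  \sum_(r <= k < N.+1) 'C(N, k)%:R * b ^+ k * (1 - b) ^+ (N - k).
Proof.
move=> mB indB PB.
have mD := discrete_rv_correct_set mB.
have scoreE t : score B t = #|correct_set B t|.
  rewrite /score /correct_set -sum1dep_card [RHS]big_mkcond/=.
  by apply: eq_bigr => i _; case: (B i t).
rewrite /pass_probability.
rewrite (probability_partition P mD); last first.
  rewrite (_ : [set t | _] = correct_set B @^-1` [set A : {set 'I_N}| (r <= #|A|)%N]).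
    exact: mD.
  by apply/seteqP; split=> t /=; rewrite scoreE.
(* The value [A] determines the score, so its fibre lies entirely inside the passing event or is
   disjoint from it. *)
have term (A : {set 'I_N}) :
    P ([set t | (r <= score B t)%N] `&` correct_set B @^-1` [set A]) =
    (if (r <= #|A|)%N then b ^+ #|A| * (1 - b) ^+ (N - #|A|) else 0)%:E.
  case: ifPn => rA.
    have := probability_correct_set A mB indB PB; rewrite card_ord => <-.
    congr (P _); apply/seteqP; split=> [t []//|t /= tA]; split=> //=.
    by rewrite scoreE tA.
  rewrite [X in P X](_ : _ = set0) ?measure0//.
  by apply/seteqP; split=> // t /= [+ tA]; rewrite scoreE tA (negPf rA).
rewrite (eq_bigr _ (fun A _ => term A)) sumEFin/= -big_mkcond/=.
(* The sets are grouped by size. Since [#|A| <= N], [inord] never falls back on its default value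
   here. *)
rewrite (partition_big (fun A : {set 'I_N} => inord #|A| : 'I_N.+1)
           (fun k => r <= k)%N); last first.
  by move=> A rA; rewrite inordK// ltnS -[leqRHS](card_ord N) max_card.
rewrite big_geq_mkord; apply: eq_bigr => k rk.
have cardA (A : {set 'I_N}) : (#|A| < N.+1)%N.
  by rewrite ltnS -[leqRHS](card_ord N) max_card.
have := card_draws 'I_N k; rewrite card_ord => <-.
(* The binomial coefficient is unfolded into a constant sum over the subsets of size [k], to be
   matched term by term. The condition [r <= #|A|] then follows from [r <= k]. *)
rewrite -mulrA mulr_natl -sumr_const; apply: eq_big => A; rewrite ?inE.
  by rewrite -val_eqE/= inordK//; apply: andb_idl => /eqP ->.
by rewrite -val_eqE/= inordK// => /andP[_ /eqP ->].
Qed.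

Lemma probability_setICC d (T : measurableType d) (R : realType)
    (P : probability T R) (A B : set T) (a b : R) :
  measurable A -> measurable B ->
  P A = a%:E -> P B = b%:E -> P (A `&` B) = (P A * P B)%E ->
  P (~` A `&` ~` B) = ((1 - a) * (1 - b))%:E.
Proof.
move=> mA mB PA PB; rewrite PA PB => PAB.
have : P B = (P (~` A `&` B) + P (A `&` B))%E.
  by rewrite [LHS](measureDI P mB mA) setDE setIC (setIC B).
have : P (~` A) = (P (~` A `&` ~` B) + P (~` A `&` B))%E.
  exact: measureDI (measurableC mA) mB.
rewrite PAB PB probability_setC// PA.
have mBA : measurable (~` A `&` B) by apply: measurableI => //; exact: measurableC.
have mAB : measurable (~` A `&` ~` B) by apply: measurableI; exact: measurableC.
(* Finiteness of both probabilities turns the two decompositions into real equations, linear once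
   [a * b] is treated as an atom. *)
rewrite -(fineK (fin_num_measure P _ mBA)) -(fineK (fin_num_measure P _ mAB)).
rewrite -EFinB -!EFinD => -[aE] -[bE]; congr EFin.
rewrite mulrBl !mulrBr; lra.
Qed.

Lemma received_correct d (T : measurableType d) (R : realType)
    (P : probability T R) (N M : nat) (p alpha : R) (key : 'I_N -> 'I_M)
    (answer received : 'I_N -> T -> 'I_M) (i : 'I_N) :
  attack P p alpha key answer received ->
  P [set t | received i t == key i] =
  (p * alpha + (1 - p) * (1 - alpha) / (M%:R - 1))%:E.
Proof.
move=> att.
have mAR (E : set ('I_M * 'I_M)) : measurable [set t | E (answer i t, received i t)].
  exact: (discrete_rv_pair (attack_answer_rv att i) (attack_received_rv att i)).
set K := [set t | answer i t = key i].
set G := [set t | received i t = answer i t].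
set C := [set t | _].
have mK : measurable K by exact: (mAR [set ab | ab.1 = key i]).
have mG : measurable G by exact: (mAR [set ab | ab.2 = ab.1]).
have mC : measurable C by exact: (mAR [set ab | ab.2 == key i]).
have -> : P C = (P (C `&` K) + P (C `\` K))%E.
  by rewrite addeC; exact: measureDI.
(* The first summand comes from the identity of [C] and [G] on [K]: when the answer is right,
   receiving the key means being recognized. *)
rewrite EFinD; congr (_ + _)%E.
  rewrite EFinM -(attack_knowledge att i) -(attack_skill att i).
  rewrite -(attack_skill_knowledge att i); congr (P _).
  apply/seteqP; split=> t /= [].
    by move=> /eqP rA aK; rewrite rA aK.
  by move=> aK rA; split=> //; rewrite /C/= rA aK.
have PKG := probability_setICC mK mG (attack_knowledge att i) (attack_skill att i)
  (attack_skill_knowledge att i).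
rewrite EFinM -PKG.
have mX := attack_answer_rv att i.
(* Both sides are cut along the chosen option [a], because the confusion hypothesis is stated for
   each option separately. *)
rewrite (probability_partition P mX (measurableD mC mK)).
rewrite (probability_partition P mX (A := ~` K `&` ~` G)); last first.
  by apply: measurableI; exact: measurableC.
rewrite ge0_sume_distrl//; apply: eq_bigr => a _.
(* For [a = key i] both events are empty, as they require a wrong answer. For any other [a],
   confusion applies with the key as received option. *)
have [aK|aK] := eqVneq a (key i).
  rewrite (_ : _ `&` _ = set0) ?measure0; last first.
    by apply/seteqP; split=> // t [[_ nK] /= aE]; apply: nK; rewrite /K/= aE.
  rewrite (_ : _ `&` _ `&` _ = set0) ?measure0 ?mul0e//.
  by apply/seteqP; split=> // t [[nK _] /= aE]; apply: nK; rewrite /K/= aE.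
have := attack_confusion att i (a := a) (b := key i).
rewrite eq_sym aK => /(_ isT) conf.
transitivity (P [set t | answer i t = a /\ received i t = key i]).
  congr (P _); apply/seteqP; split=> [t [[/eqP] ]|t [/= aE rE]]//.
  by split=> //; split; [exact/eqP|rewrite /K/= aE; exact/eqP].
rewrite conf; congr (P _ * _)%E.
apply/seteqP; split=> [t [/= aE rE]|t [[nK nG] /= aE]].
  by split=> //; split; rewrite /K /G/= aE//; exact/eqP.
by split=> // rE; apply: nG; rewrite /G/= aE.
Qed.

Theorem theorem1 (R : realType) (d : measure_display) (T : measurableType d)
    (P : probability T R) (N M r : nat) (p alpha theta : R)
    (key : 'I_N -> 'I_M) (answer received : 'I_N -> T -> 'I_M)
    (correct : 'I_N -> T -> bool)
    (HN : (1 <= N)%N) (HM : (1 < M)%N) (Hr : (r <= N)%N)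
    (Hp : 0 <= p <= 1) (Halpha : 0 <= alpha <= 1) (Htheta : 0 <= theta <= 1)
    (Hattack : attack P p alpha key answer received)
    (Hclean : clean_option P theta correct) :
  let beta := p * alpha + (1 - p) * (1 - alpha) / (M%:R - 1) in
  let X := score (fun i t => received i t == key i) in
  let Y := score correct in
  pass_ratio P r X Y =
    (\sum_(r <= k < N.+1) 'C(N, k)%:R * beta ^+ k * (1 - beta) ^+ (N - k)) /
    (\sum_(r <= k < N.+1) 'C(N, k)%:R * theta ^+ k * (1 - theta) ^+ (N - k)).
Proof.
(* Numerators and denominators are matched separately, so a zero denominator, where division returns
   0, calls for no case distinction. *)
move=> beta X Y; rewrite /pass_ratio; congr (_ / _).
  apply: pass_probability_binomial => [i E|| i].
  - exact: (attack_received_rv Hattack i [set b | E (b == key i)]).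
  - exact: (mutually_independent_comp (fun i ab => ab.2 == key i)
      (attack_questions_independent Hattack)).
  - exact: received_correct Hattack.
apply: pass_probability_binomial.
- exact: clean_correct_rv Hclean.
- exact: clean_questions_independent Hclean.
- exact: clean_theta Hclean.
Qed.
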